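(* Let $g,h:\mathbb R^m\to\mathbb R\cup\{+\infty\}$ be lsc and let $s_g$ and $s_h$ be epi-smoothing functions for $g$ and $h$, respectively. Then the following hold: (a) If $s_g$ converges continuously to $g$, i.e. $\lim_{\mu\downarrow 0,\,x\to\bar x}s_g(x,\mu)=g(\bar x)$ for all $\bar x\in\mathbb R^m$, then $s_f:=s_g+s_h$ is an epi-smoothing function for $f:=g+h$. (b) If $g$ is (real-valued and) continuously differentiable, then $s_f:(x,\mu)\mapsto g(x)+s_h(x,\mu)$ is an epi-smoothing function for $f:=g+h$. (c) If $\lambda>0$, then $\lambda s_g$ is an epi-smoothing function for $\lambda g$. (d) If $A\in\mathbb R^{m\times n}$ has rank $m$ and $b\in\mathbb R^m$, then $s_f:(x,\mu)\mapsto s_g(Ax+b,\mu)$ is an epi-smoothing function for $f:\mathbb R^n\to\mathbb R\cup\{+\infty\}$, $f(x):=g(Ax+b)$.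
   Context: For $f:\mathbb R^p\to\mathbb R\cup\{\pm\infty\}$, $\operatorname{epi} f:=\{(x,\alpha)\in\mathbb R^p\times\mathbb R\mid f(x)\le\alpha\}$; $f$ is lower semicontinuous (lsc) if $\operatorname{epi} f$ is closed. A sequence $f_k$ epi-converges to $f$ if $\operatorname{epi} f_k\to\operatorname{epi} f$ in the Painlevé–Kuratowski sense; equivalently, for every $\bar x$: (i) $\liminf_k f_k(x^k)\ge f(\bar x)$ for every sequence $x^k\to\bar x$, and (ii) there is a sequence $x^k\to\bar x$ with $\limsup_k f_k(x^k)\le f(\bar x)$. The notation $\mu_k\downarrow0$ means $\mu_k>0$ and $\mu_k\to0$. Epi-smoothing function: let $f:\mathbb R^p\to\mathbb R\cup\{+\infty\}$ be lsc. A function $s_f:\mathbb R^p\times\mathbb R_+\to\mathbb R$ is an epi-smoothing function for $f$ if (i) for every sequence $\mu_k\downarrow 0$, $s_f(\cdot,\mu_k)$ epi-converges to $f$, and (ii) $s_f(\cdot,\mu)$ is continuously differentiable for every $\mu>0$. (Only the values for $\mu>0$ matter.) *)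

(* Defs.v *)
From mathcomp Require Export all_boot all_order all_algebra.
From mathcomp Require Export all_classical all_reals all_analysis.
Import Order.TTheory GRing.Theory Num.Theory.
Import numFieldNormedType.Exports.

Set Implicit Arguments.
Unset Strict Implicit.
Unset Printing Implicit Defensive.

Local Open Scope classical_set_scope.
Local Open Scope ring_scope.

(* Painleve-Kuratowski limits of a sequence of sets, in sequential form.      *)
Definition inner_limit (T : topologicalType) (S : nat -> set T) : set T :=
  [set x | exists2 u : nat -> T,
     \forall k \near \oo, S k (u k) & u k @[k --> \oo] --> x].

Definition outer_limit (T : topologicalType) (S : nat -> set T) : set T :=
  [set x | exists (phi : nat -> nat) (u : nat -> T),
     [/\ {homo phi : i j / (i < j)%N}, forall k, S (phi k) (u k) &
         u k @[k --> \oo] --> x]].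

Definition set_converges (T : topologicalType) (S : nat -> set T) (A : set T) :=
  inner_limit S = A /\ outer_limit S = A.

Definition epi (R : realType) (p : nat) (f : 'cV[R]_p -> \bar R) :
    set ('cV[R]_p * R) :=
  [set z | (f z.1 <= z.2%:E)%E].

(* Closedness of the epigraph is taken as the definition; the library's       *)
(* lower_semicontinuous is phrased pointwise.                                 *)
Definition lsc (R : realType) (p : nat) (f : 'cV[R]_p -> \bar R) :=
  closed (epi f).

Definition epi_converges (R : realType) (p : nat)
    (fk : nat -> 'cV[R]_p -> \bar R) (f : 'cV[R]_p -> \bar R) :=
  set_converges (fun k => epi (fk k)) (epi f).

Definition gradient (R : realType) (p : nat) (f : 'cV[R]_p -> R)
    (x : 'cV[R]_p) : 'cV[R]_p :=
  \col_i 'd f x (delta_mx i 0).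

Definition continuously_differentiable (R : realType) (p : nat)
    (f : 'cV[R]_p -> R) :=
  (forall x, differentiable f x) /\ continuous (gradient f).

(* s x mu is only constrained for mu > 0, so the domain R^p x R_+ is          *)
(* represented by a total function of mu. The standing requirements on f      *)
(* (no value -oo, lsc) are part of being epi-smoothed.                        *)
Definition epi_smoothing (R : realType) (p : nat)
    (s : 'cV[R]_p -> R -> R) (f : 'cV[R]_p -> \bar R) :=
  [/\ forall x, f x != -oo%E,
      lsc f,
      (forall mu : nat -> R,
         (forall k, 0 < mu k) -> mu k @[k --> \oo] --> (0 : R) ->
         epi_converges (fun k x => (s x (mu k))%:E) f) &
      (forall mu : R, 0 < mu -> continuously_differentiable (s ^~ mu))].

(* Joint limit as x tends to xbar (unrestricted) and mu tends to 0 from the   *)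
(* right; the limit g xbar may be +oo.                                        *)
Definition converges_continuously (R : realType) (p : nat)
    (s : 'cV[R]_p -> R -> R) (g : 'cV[R]_p -> \bar R) :=
  forall xbar : 'cV[R]_p,
    (s z.1 z.2)%:E @[z --> filter_prod (nbhs xbar) ((0 : R)^'+)] --> g xbar.

(* Main.v *)
Require Import Defs.
From mathcomp Require Import lra.
Import Order.TTheory GRing.Theory Num.Theory.
Import numFieldNormedType.Exports.

Set Implicit Arguments.
Unset Strict Implicit.
Unset Printing Implicit Defensive.

Local Open Scope classical_set_scope.
Local Open Scope ring_scope.

(** An epi-smoothing function has two features to carry over: epi-convergence
    along every sequence of parameters, and smoothness for each parameter.
    Lower semicontinuity of the limit takes no separate argument, because a
    Painleve-Kuratowski limit of sets in a pseudometric space is always closed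
    ([set_converges_closed]); this is used through [epi_smoothingI].

    Scaling and surjective affine substitution act on epigraphs as preimages:
    [epi (l f)] is the preimage of [epi f] under [(x, a) |-> (x, a / l)], and
    the epigraph of [f (A x + b)] is the preimage under
    [(x, a) |-> (A x + b, a)]. Preimages preserve set convergence as soon as
    the map is continuous and has a continuous section through each point
    ([set_converges_preimage]): continuity pushes outer limits forward, the
    sections lift recovery sequences back. For the affine map the sections come
    from a right inverse of [A], which is where the rank hypothesis enters.

    For sums ([epi_convergesD]), subtracting the values of the continuously
    convergent summand turns points of [epi (g_k + h_k)] into points of
    [epi h_k], and adding them goes back. Continuous convergence says that
    these values tend to [g x] along any sequence tending to [x], so only a
    limit equal to [+oo] requires more care. The case of a [C^1] function [g]
    is the instance in which [g_k] does not depend on [k]. *)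

(** * Painleve-Kuratowski convergence *)

(** The instance of [cvg_pair] at neighbourhood filters, in the form that unifies
    with goals whose limit is a point of a product space. *)
Lemma cvg_pair_nbhs (I : Type) (F : set_system I) (T U : topologicalType)
    (f : I -> T) (g : I -> U) (a : T) (b : U) : Filter F ->
  f @ F --> a -> g @ F --> b -> (f i, g i) @[i --> F] --> (a, b).
Proof. by move=> FF fa gb; exact: (cvg_pair fa gb). Qed.

Lemma homo_ltn_cvg_oo (phi : nat -> nat) :
  {homo phi : i j / (i < j)%N} -> phi k @[k --> \oo] --> \oo.
Proof.
move=> phi_incr.
have phi_ge k : (k <= phi k)%N.
  by elim: k => // k /leq_ltn_trans; apply; exact: phi_incr.
by apply/cvgnyPge => N; near=> k; apply: leq_trans (phi_ge k); near: k;
  exact: nbhs_infty_ge.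
Unshelve. all: by end_near. Qed.

(** Dropping finitely many terms leaves a strictly increasing extraction, so
    membership is only needed eventually along the subsequence. *)
Lemma outer_limit_near (T : topologicalType) (S : nat -> set T)
    (phi : nat -> nat) (u : nat -> T) (x : T) :
  {homo phi : i j / (i < j)%N} -> (\forall k \near \oo, S (phi k) (u k)) ->
  u k @[k --> \oo] --> x -> outer_limit S x.
Proof.
move=> phi_incr [N _ SuN] ux.
have shift_incr : {homo addn N : i j / (i < j)%N}.
  by move=> i j; rewrite ltn_add2l.
exists (phi \o addn N), (u \o addn N); split => /=.
- by move=> i j /shift_incr/phi_incr.
- by move=> k; apply: SuN => /=; rewrite leq_addr.
- exact: cvg_comp (homo_ltn_cvg_oo shift_incr) ux.
Qed.

Lemma set_convergesI (T : topologicalType) (S : nat -> set T) (A : set T) :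
  A `<=` inner_limit S -> outer_limit S `<=` A -> set_converges S A.
Proof.
move=> A_inner outer_A.
have inner_outer : inner_limit S `<=` outer_limit S.
  by move=> x [u Su ux]; exact: (@outer_limit_near _ _ id u).
split; apply/seteqP; split => //.
- exact: subset_trans outer_A.
- exact: subset_trans inner_outer.
Qed.

(** Diagonal extraction: every ball around a point of the closure of the outer
    limit meets [S k] for arbitrarily large [k], so one can choose inductively
    strictly increasing indices and points in balls of radii shrinking to 0. *)
Lemma set_converges_closed (R : realType) (T : pseudoMetricType R)
    (S : nat -> set T) (A : set T) : set_converges S A -> closed A.
Proof.
move=> [_ outerE] x clAx; rewrite -outerE.
have pick (nN : nat * nat) : exists ku : nat * T,
    [/\ (nN.2 < ku.1)%N, S ku.1 ku.2 & ball x (harmonic nN.1) ku.2].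
  case: nN => n N /=.
  have [y [Ay xy]] := clAx (ball x (harmonic n))°
    (nbhs_interior (nbhsx_ballx x _ (harmonic_gt0 n))).
  move: Ay; rewrite -outerE => -[phi [u [phi_incr Su uy]]].
  have [k [/= Nk xuk]] := @filter_ex _ \oo _ _ (filterI
    ((cvgnyPgt _).1 (homo_ltn_cvg_oo phi_incr) N) (uy _ xy)).
  exists (phi k, u k); split=> /=; [exact: Nk | exact: Su | exact: xuk].
have [F FP] := choice pick.
(* The first component of [z n] is the chosen index; feeding it back into [F]
   makes the next index strictly larger. *)
pose fix z n : nat * T :=
  if n is n'.+1 then F (n, (z n').1) else F (0%N, 0%N).
have zP n : S (z n).1 (z n).2 /\ ball x (harmonic n) (z n).2.
  by case: n => [|n]; [have [] := FP (0, 0)%N | have [] := FP (n.+1, (z n).1)].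
apply: (@outer_limit_near _ _ (fun n => (z n).1) (fun n => (z n).2)).
- apply: homo_ltn => [k i j|n]; first exact: ltn_trans.
  by have [] := FP (n.+1, (z n).1).
- by apply: nearW => n; have [] := zP n.
- apply/cvg_ballP => e e0; near=> n; have [_] := zP n; apply: le_ball.
  by apply/ltW; near: n; exact: (cvgr_lt 0 (@cvg_harmonic R)).
Unshelve. all: by end_near. Qed.

(** The section may depend on the point [x], but must be a right inverse of
    [phi] everywhere: it carries a sequence converging to [phi x] to one that
    converges to [x] and lies in the preimages. *)
Lemma set_converges_preimage (T T' : topologicalType) (phi : T -> T')
    (S : nat -> set T') (A : set T') :
  continuous phi ->
  (forall x, exists psi : T' -> T,
    [/\ {for phi x, continuous psi}, psi (phi x) = x & cancel psi phi]) ->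
  set_converges S A ->
  set_converges (fun k => phi @^-1` S k) (phi @^-1` A).
Proof.
move=> phi_cont phi_section [innerE outerE]; apply: set_convergesI.
- move=> x /=; rewrite -innerE => -[u Su ux].
  have [psi [psi_cont psix psiK]] := phi_section x.
  exists (psi \o u).
    by apply: filterS Su => k; rewrite /= psiK.
  by rewrite -psix; exact: cvg_comp ux psi_cont.
- move=> x [s [u [s_incr Su ux]]] /=; rewrite -outerE.
  exists s, (phi \o u); split=> //.
  by apply: cvg_comp ux _; exact: phi_cont.
Qed.

(** The hypothesis on [gk] is continuous convergence: [gk k y] tends to [g x]
    when [k] tends to infinity and [y] to [x] jointly. *)
Lemma epi_convergesD (R : realType) (p : nat)
    (gk hk : nat -> 'cV[R]_p -> R) (g h : 'cV[R]_p -> \bar R) :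
  (forall x, g x != -oo%E) -> (forall x, h x != -oo%E) ->
  (forall x, (gk z.2 z.1)%:E @[z --> filter_prod (nbhs x) \oo] --> g x) ->
  epi_converges (fun k x => (hk k x)%:E) h ->
  epi_converges (fun k x => (gk k x + hk k x)%:E) (fun x => (g x + h x)%E).
Proof.
move=> g_noo h_noo g_cvg [innerE outerE]; apply: set_convergesI.
(* Recovery sequences: since neither function takes the value [-oo], a finite
   upper bound on the sum makes [g x] finite. *)
- move=> [x a]; rewrite /epi /= => gha.
  have [r gxE] : exists r, g x = r%:E.
    move: gha (g_noo x) (h_noo x).
    by case: (g x) => [r| |] //; [exists r | case: (h x)].
  move: gha; rewrite gxE addeC -leeBrDr // -EFinB => ha.
  have : inner_limit (fun k => epi (fun x => (hk k x)%:E)) (x, a - r).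
    by rewrite innerE.
  move=> [u Su ux].
  have u1 : (u k).1 @[k --> \oo] --> x by exact: cvg_comp ux cvg_fst.
  have u2 : (u k).2 @[k --> \oo] --> a - r by exact: cvg_comp ux cvg_snd.
  have gu : gk k (u k).1 @[k --> \oo] --> r.
    apply: (@fine_cvg _ _ \oo _ (fun k => (gk k (u k).1)%:E)); rewrite -gxE.
    exact: cvg_comp (cvg_pair u1 (@cvg_id _ \oo)) (g_cvg x).
  exists (fun k => ((u k).1, gk k (u k).1 + (u k).2)).
    by apply: filterS Su => k /=; rewrite !lee_fin lerD2l.
  have -> : a = r + (a - r) by rewrite addrC subrK.
  by apply: cvg_pair_nbhs => //; exact: cvgD.
- move=> [x a] [phi [u [phi_incr Su ux]]].
  have u1 : (u k).1 @[k --> \oo] --> x by exact: cvg_comp ux cvg_fst.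
  have u2 : (u k).2 @[k --> \oo] --> a by exact: cvg_comp ux cvg_snd.
  have gu : (gk (phi k) (u k).1)%:E @[k --> \oo] --> g x.
    exact: cvg_comp (cvg_pair u1 (homo_ltn_cvg_oo phi_incr)) (g_cvg x).
  (* The lower bound for [h], tested along the given subsequence of points but
     with freely chosen heights [b]. *)
  have h_le (b : nat -> R) (c : R) : b k @[k --> \oo] --> c ->
      (\forall k \near \oo, hk (phi k) (u k).1 <= b k) -> (h x <= c%:E)%E.
    move=> bc hb; have : epi h (x, c); last by [].
    rewrite -outerE.
    apply: (@outer_limit_near _ _ phi (fun k => ((u k).1, b k))) => //.
    exact: cvg_pair_nbhs.
  rewrite /epi /=; case gxE : (g x) (g_noo x) => [r| |] // _.
  + rewrite addeC -leeBrDr // -EFinB.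
    apply: (h_le (fun k => (u k).2 - gk (phi k) (u k).1)).
      apply: cvgB => //.
      apply: (@fine_cvg _ _ \oo _ (fun k => (gk (phi k) (u k).1)%:E)).
      by rewrite -gxE.
    by near=> k; have := Su k; rewrite /epi /= lee_fin => ?; lra.
  (* If [g x] is [+oo], the heights left for [h] tend to [-oo]; then [h x]
     is below every real number, which is excluded. *)
  + have h_le_all c : (h x <= c%:E)%E.
      apply: (h_le (fun=> c)); first exact: cvg_cst.
      rewrite gxE in gu.
      have u2_lt : \forall k \near \oo, (u k).2 < a + 1.
        by apply: (cvgr_lt a) => //; rewrite ltrDl.
      near=> k; have := Su k; rewrite /epi /= lee_fin => ?.
      have ? : (u k).2 < a + 1 by near: k.
      have : ((a + 1 - c)%:E <= (gk (phi k) (u k).1)%:E)%E.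
        by near: k; move/cvgeyPge : gu; apply.
      rewrite lee_fin => ?; lra.
    exfalso; case hxE : (h x) (h_noo x) => [r| |] // _.
      by have := h_le_all (r - 1); rewrite hxE lee_fin; lra.
    by have := h_le_all 0; rewrite hxE.
Unshelve. all: by end_near. Qed.

(** * Continuously differentiable functions *)

Lemma continuously_differentiableD (R : realType) (p : nat)
    (f g : 'cV[R]_p -> R) :
  continuously_differentiable f -> continuously_differentiable g ->
  continuously_differentiable (fun x => f x + g x).
Proof.
move=> [df cf] [dg cg]; split=> [x|]; first exact: differentiableD.
have -> : gradient (fun x => f x + g x) =
    fun x => gradient f x + gradient g x.
  by apply/funext => x; apply/colP => i; rewrite !mxE diffD.
by move=> x; exact: cvgD (cf x) (cg x).
Qed.

Lemma continuously_differentiableZ (R : realType) (p : nat) (l : R)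
    (f : 'cV[R]_p -> R) :
  continuously_differentiable f ->
  continuously_differentiable (fun x => l * f x).
Proof.
move=> [df cf]; split=> [x|]; first exact: (differentiableZ l (df x)).
have -> : gradient (fun x => l * f x) = fun x => l *: gradient f x.
  by apply/funext => x; apply/colP => i; rewrite !mxE (diffZ l (df x)).
by move=> x; exact: cvgZl_tmp (cf x).
Qed.

Lemma mulmx_cV_continuous (R : realType) (m n : nat) (A : 'M[R]_(m, n)) :
  continuous (fun x : 'cV[R]_n => A *m x).
Proof.
(* As a combination of the columns of [A], the product is a sum of continuous
   coordinates with constant vectors. *)
have -> : (fun x : 'cV[R]_n => A *m x) = fun x => \sum_j x j 0 *: col j A.
  apply/funext => x; apply/colP => i; rewrite mxE summxE.
  by apply: eq_bigr => j _; rewrite !mxE mulrC.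
apply: continuous_big => [|j _ x]; first exact: add_continuous.
exact: cvgZr_tmp (@coord_continuous _ _ _ j 0 x).
Qed.

Lemma affine_cV_continuous (R : realType) (m n : nat) (A : 'M[R]_(m, n))
    (b : 'cV[R]_m) : continuous (fun x : 'cV[R]_n => A *m x + b).
Proof.
by move=> x; exact: cvgD (@mulmx_cV_continuous R m n A x) (cvg_cst b).
Qed.

(** Chain rule: the gradient of [f (A x + b)] is [A^T] applied to the gradient
    of [f] at [A x + b], a composition of continuous maps. *)
Lemma continuously_differentiable_affine (R : realType) (m n : nat)
    (A : 'M[R]_(m, n)) (b : 'cV[R]_m) (f : 'cV[R]_m -> R) :
  continuously_differentiable f ->
  continuously_differentiable (fun x : 'cV[R]_n => f (A *m x + b)).
Proof.
move=> [df cf]; have A_cont := @mulmx_cV_continuous R m n A.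
have A_diff (x : 'cV[R]_n) : is_diff x (mulmx A) (mulmx A).
  by apply: DiffDef; [exact: linear_differentiable|rewrite diff_lin].
have T_diff (x : 'cV[R]_n) :
    is_diff x (fun y : 'cV[R]_n => A *m y + b) (mulmx A).
  have := is_diffD (A_diff x) (is_diff_cst b x); rewrite addr0; exact.
have fT_diff (x : 'cV[R]_n) : is_diff x (fun y : 'cV[R]_n => f (A *m y + b))
    ('d f (A *m x + b) \o mulmx A).
  exact: (is_diff_comp (T_diff x) (differentiableP (df _))).
split=> [x|]; first by have [] := fT_diff x.
have -> : gradient (fun x : 'cV[R]_n => f (A *m x + b)) =
    fun x => A^T *m gradient f (A *m x + b).
  apply/funext => x; apply/colP => i; rewrite !mxE.
  have -> : 'd (fun y : 'cV[R]_n => f (A *m y + b)) x (delta_mx i 0) =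
      'd f (A *m x + b) (col i A) by rewrite diff_val /= -colE.
  have -> : col i A = \sum_j A j i *: delta_mx j 0.
    apply/colP => k; rewrite mxE summxE (bigD1 k) //= !mxE !eqxx mulr1.
    rewrite big1 ?addr0 // => j /negPf jk.
    by rewrite !mxE eq_sym jk mulr0.
  rewrite linear_sum; apply: eq_bigr => j _.
  by rewrite linearZ !mxE.
move=> x; apply: continuous_comp; last exact: mulmx_cV_continuous.
by apply: continuous_comp; [exact: affine_cV_continuous|exact: cf].
Qed.

(** * Epi-smoothing functions *)

(** Closedness of the epigraph follows from epi-convergence along any single
    admissible sequence of parameters, here the harmonic one. *)
Lemma epi_smoothingI (R : realType) (p : nat)
    (s : 'cV[R]_p -> R -> R) (f : 'cV[R]_p -> \bar R) :
  (forall x, f x != -oo%E) ->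
  (forall mu : nat -> R,
     (forall k, 0 < mu k) -> mu k @[k --> \oo] --> (0 : R) ->
     epi_converges (fun k x => (s x (mu k))%:E) f) ->
  (forall mu : R, 0 < mu -> continuously_differentiable (s ^~ mu)) ->
  epi_smoothing s f.
Proof.
move=> f_noo f_epi s_C1; split=> //.
exact: set_converges_closed (f_epi _ (@harmonic_gt0 R) cvg_harmonic).
Qed.

(** Covers both a continuously convergent smoothing of [g] and, when [g] is
    itself smooth, the function [g] taken constant in [mu]. *)
Lemma epi_smoothingD (R : realType) (p : nat)
    (s t : 'cV[R]_p -> R -> R) (g h : 'cV[R]_p -> \bar R) :
  (forall x, g x != -oo%E) -> converges_continuously s g ->
  (forall mu : R, 0 < mu -> continuously_differentiable (s ^~ mu)) ->
  epi_smoothing t h ->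
  epi_smoothing (fun x mu => s x mu + t x mu) (fun x => (g x + h x)%E).
Proof.
move=> g_noo sg s_C1 [h_noo _ th t_C1]; apply: epi_smoothingI.
- by move=> x; rewrite adde_eq_ninfty negb_or g_noo h_noo.
- move=> mu mu0 mu_cvg.
  apply: (epi_convergesD (gk := fun k => s ^~ (mu k))) => //; last exact: th.
  have mu_right : mu k @[k --> \oo] --> 0^'+.
    move=> P P0; have : \forall k \near \oo, 0 < mu k -> P (mu k).
      exact: mu_cvg P0.
    by apply: filterS => k; apply; exact: mu0.
  move=> x.
  have xmu : (z.1, mu z.2) @[z --> filter_prod (nbhs x) \oo] -->
      filter_prod (nbhs x) 0^'+.
    exact: (cvg_pair cvg_fst (cvg_comp _ _ cvg_snd mu_right)).
  exact: cvg_comp xmu (sg x).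
- by move=> mu mu0; apply: continuously_differentiableD;
    [exact: s_C1|exact: t_C1].
Qed.

(** The map [phi] below is a homeomorphism; its sections are its inverse. *)
Lemma epi_smoothingZ (R : realType) (p : nat) (l : R)
    (s : 'cV[R]_p -> R -> R) (f : 'cV[R]_p -> \bar R) :
  0 < l -> epi_smoothing s f ->
  epi_smoothing (fun x mu => l * s x mu) (fun x => (l%:E * f x)%E).
Proof.
move=> l0 [f_noo _ sf s_C1].
pose phi (z : 'cV[R]_p * R) := (z.1, l^-1 * z.2).
have epiZ (f' : 'cV[R]_p -> \bar R) :
    epi (fun x => (l%:E * f' x)%E) = phi @^-1` epi f'.
  apply/seteqP; split => -[x a]; rewrite /epi /phi /=;
    by rewrite EFinM lee_pdivlMl.
apply: epi_smoothingI.
- move=> x; case: (f x) (f_noo x) => [r| |] // _.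
  by rewrite gt0_muley ?lte_fin.
- move=> mu mu0 mu_cvg; rewrite /epi_converges epiZ.
  have -> : (fun k => epi (fun x => (l * s x (mu k))%:E)) =
      fun k => phi @^-1` epi (fun x => (s x (mu k))%:E).
    by apply/funext => k; rewrite -epiZ.
  apply: set_converges_preimage (sf _ mu0 mu_cvg).
    move=> z; apply: cvg_pair_nbhs; first exact: cvg_fst.
    by apply: cvgMl_tmp; exact: cvg_snd.
  move=> z; exists (fun w => (w.1, l * w.2)); split.
  + apply: cvg_pair_nbhs; first exact: cvg_fst.
    by apply: cvgMl_tmp; exact: cvg_snd.
  + by rewrite /phi /= mulVKf ?gt_eqF //; case: z.
  + by move=> [x a]; rewrite /phi /= mulKf ?gt_eqF.
- by move=> mu mu0; apply: continuously_differentiableZ; exact: s_C1.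
Qed.

(** Full row rank gives a right inverse [B] of [A]; the section through a point
    [z] sends [y] to [z.1 + B (y - (A z.1 + b))], written below as an affine map
    in [y]. *)
Lemma epi_smoothing_affine (R : realType) (m n : nat) (A : 'M[R]_(m, n))
    (b : 'cV[R]_m) (s : 'cV[R]_m -> R -> R) (f : 'cV[R]_m -> \bar R) :
  row_free A -> epi_smoothing s f ->
  epi_smoothing (fun (x : 'cV[R]_n) mu => s (A *m x + b) mu)
                (fun x : 'cV[R]_n => f (A *m x + b)).
Proof.
move=> /row_freeP[B AB1] [f_noo _ sf s_C1].
pose phi (z : 'cV[R]_n * R) := (A *m z.1 + b, z.2).
apply: epi_smoothingI => //.
- move=> mu mu0 mu_cvg.
  apply: (@set_converges_preimage _ _ phi) (sf _ mu0 mu_cvg).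
    move=> z; apply: cvg_pair_nbhs; last exact: cvg_snd.
    apply: (@continuous_comp _ _ _ fst (fun x : 'cV[R]_n => A *m x + b)).
      exact: cvg_fst.
    exact: affine_cV_continuous.
  move=> z; pose c := z.1 - B *m (A *m z.1 + b).
  exists (fun w => (B *m w.1 + c, w.2)); split.
  + apply: cvg_pair_nbhs; last exact: cvg_snd.
    apply: (@continuous_comp _ _ _ fst (fun x : 'cV[R]_m => B *m x + c)).
      exact: cvg_fst.
    exact: affine_cV_continuous.
  + by rewrite /phi /c /= addrC subrK -surjective_pairing.
  + move=> [y a]; rewrite /phi /c /= mulmxDr mulmxBr !mulmxA AB1 !mul1mx.
    by congr (_, _); rewrite opprD addNKr subrK.
- move=> mu mu0.
  exact: (continuously_differentiable_affine A b (s_C1 mu mu0)).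
Qed.

Theorem proposition3p1 (R : realType) (m : nat)
    (g h : 'cV[R]_m -> \bar R) (s_g s_h : 'cV[R]_m -> R -> R)
    (g_noo : forall x, g x != -oo%E) (h_noo : forall x, h x != -oo%E)
    (g_lsc : lsc g) (h_lsc : lsc h)
    (g_smooth : epi_smoothing s_g g) (h_smooth : epi_smoothing s_h h) :
  [/\
    converges_continuously s_g g ->
      epi_smoothing (fun x mu => s_g x mu + s_h x mu)
                    (fun x => (g x + h x)%E),
    (forall x, g x \is a fin_num) ->
      continuously_differentiable (fine \o g) ->
      epi_smoothing (fun x mu => fine (g x) + s_h x mu)
                    (fun x => (g x + h x)%E),
    forall lambda : R, 0 < lambda ->
      epi_smoothing (fun x mu => lambda * s_g x mu)
                    (fun x => (lambda%:E * g x)%E) &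
    forall (n : nat) (A : 'M[R]_(m, n)) (b : 'cV[R]_m), \rank A = m ->
      epi_smoothing (fun (x : 'cV[R]_n) mu => s_g (A *m x + b) mu)
                    (fun x : 'cV[R]_n => g (A *m x + b))].
Proof.
split.
- by move=> sg; apply: epi_smoothingD => //; case: g_smooth.
- move=> g_fin g_C1.
  apply: (epi_smoothingD (s := fun x _ => fine (g x))) => // x.
  rewrite -[g x]fineK //.
  have g_cont : {for x, continuous (fine \o g)}.
    by case: g_C1 => g_diff _; exact: differentiable_continuous.
  apply/fine_cvgP; split; first exact: nearW.
  have fst_x : z.1 @[z --> filter_prod (nbhs x) (0^'+ : set_system R)] --> x.
    exact: cvg_fst.
  exact: (cvg_comp _ _ fst_x g_cont).
- by move=> l l0; exact: epi_smoothingZ.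
- move=> n A b rkA; apply: epi_smoothing_affine => //.
  by rewrite /row_free rkA.
Qed.
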